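(* Let $\Gamma$ be a group, let $\mathcal{L}$ be a collection of (distinguished) subgroups of $\Gamma$, and let $k$ be a fixed positive integer such that every element of $\Gamma$ can be written as a product of $k$ elements each of which is contained in some subgroup belonging to $\mathcal{L}$. Suppose that each $\Lambda\in\mathcal{L}$ is perfect and has the following property: for every positive integer $n$ there are $g_1,\ldots,g_n\in\Gamma$ such that every element of $g_i\Lambda g_i^{-1}$ commutes with every element of $g_j\Lambda g_j^{-1}$ whenever $i\neq j$. Then the stable commutator length of $\Gamma$ vanishes, i.e. $\Vert g\Vert=0$ for every $g\in[\Gamma,\Gamma]$.
   Context: For a group $\Gamma$ and $g\in[\Gamma,\Gamma]$, the commutator length $c(g)$ is the minimal number of factors needed to write $g$ as a product of single commutators of elements of $\Gamma$. The stable commutator length of $g$ is $\Vert g\Vert=\lim_{n\rightarrow\infty}\frac{c(g^n)}{n}$. A group is perfect if it equals its commutator subgroup. *)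

(* Defs.v *)
From HB Require Import structures.
From mathcomp Require Import all_boot all_order all_algebra.
From mathcomp Require Import all_classical all_reals all_analysis.

Set Implicit Arguments.
Unset Strict Implicit.
Unset Printing Implicit Defensive.

Import Order.TTheory GRing.Theory Num.Theory.
Import numFieldNormedType.Exports.

Local Open Scope classical_set_scope.
Local Open Scope group_scope.

Definition is_subgroup (G : groupType) (H : set G) : Prop :=
  group_closed (mem H).

(* MathComp's [~ x, y] is x^-1 y^-1 x y rather than x y x^-1 y^-1. Replacing
   x, y by x^-1, y^-1 exchanges the two, so the set of commutators of elements
   of a subgroup does not depend on the convention. *)
Definition commutator_subgroup (G : groupType) (H : set G) : set G :=
  smallest (@is_subgroup G) [set [~ x, y] | x in H & y in H].

Definition perfect (G : groupType) (H : set G) : Prop :=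
  commutator_subgroup H = H.

Definition is_commutator_product (G : groupType) (n : nat) (g : G) : Prop :=
  exists x y : 'I_n -> G, g = \prod_(i < n) [~ x i, y i].

(* The minimum exists for g in [G, G]; elsewhere the value is the default 0.
   The empty product is allowed, so the identity has length 0. *)
Definition commutator_length (G : groupType) (g : G) : nat :=
  xget 0%N [set n | is_commutator_product n g /\
                    forall m, is_commutator_product m g -> (n <= m)%N].

Definition scl_seq (R : realType) (G : groupType) (g : G) : R^nat :=
  fun n => ((commutator_length (g ^+ n))%:R / n%:R)%R.

(* limn takes a default value on divergent sequences, so a statement about
   scl R g is meaningful only together with cvgn (scl_seq R g). *)
Definition scl (R : realType) (G : groupType) (g : G) : R :=
  limn (scl_seq R g).

(* Main.v *)
Require Import Defs.
From HB Require Import structures.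
From mathcomp Require Import all_boot all_order all_algebra.
From mathcomp Require Import all_classical all_reals all_analysis.
From mathcomp Require Import zify.

Set Implicit Arguments.
Unset Strict Implicit.
Unset Printing Implicit Defensive.

Import Order.TTheory GRing.Theory Num.Theory.
Import numFieldNormedType.Exports.

Local Open Scope classical_set_scope.
Local Open Scope group_scope.

(** Write c for commutator length. The argument rests on two ways of trading
    commutators for powers.

    Powers of elements of a distinguished subgroup. Let f in Lambda be a product
    of m commutators of elements of Lambda, and take m conjugates of Lambda that
    commute pairwise. The map sending x to the product of its m conjugates is
    then multiplicative on Lambda, so the image of f is again a product of only
    m commutators. This image has the same factors as f ^+ m up to conjugation,
    and exchanging a factor for a conjugate costs one commutator. Hence
    c(f ^+ m) <= 2 m ([commutator_product_exp_displaced]): the m factors of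
    f ^+ m share the m commutators that a single factor needs, so that per unit
    of exponent the cost is at most 2, a constant independent of f.

    Powers of products. The element (g h)^n differs from g^n h^n by at most n
    commutators ([commutator_product_expM]). Passing to a common multiple P of
    the exponents obtained for f_1, ..., f_k, the power (f_1 ... f_k)^P has
    c at most 3 k P, so its growth rate is at most 3 k
    ([exp_prod_common_power]).

    Every element is such a product of k factors, so the bound 3 k holds
    uniformly over the group. Applied to g^n, it bounds n times the growth rate
    of c(g^N) by the constant 3 k, for every n; so this growth rate is 0. This
    amplification works because k does not depend on the element. Convergence
    comes with it, since Euclidean division by n P turns the bound for one power
    into a linear bound for all powers ([commutator_length_exp_linear]). *)

(** * Products of commutators of elements of a subset *)

(** The entries of the commutators are confined to [H]: a map that is
    multiplicative only on a subgroup can then be applied to such a product,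
    and the number of commutators is preserved. *)
Inductive commutator_product_in (G : groupType) (H : set G) : nat -> G -> Prop :=
| commutator_product_nil : commutator_product_in H 0 1
| commutator_product_cons n x y g : H x -> H y ->
    commutator_product_in H n g ->
    commutator_product_in H n.+1 ([~ x, y] * g).

Arguments commutator_product_nil {G H}.

Section CommutatorProducts.
Variables (G : groupType) (H : set G).
Implicit Types (g h x y : G) (m n : nat).

Lemma commutator_product_comm x y :
  H x -> H y -> commutator_product_in H 1 [~ x, y].
Proof.
move=> Hx Hy; rewrite -[[~ x, y]]mulg1.
exact: commutator_product_cons (commutator_product_nil).
Qed.

Lemma commutator_product_mul m n g h :
  commutator_product_in H m g -> commutator_product_in H n h ->
  commutator_product_in H (m + n) (g * h).
Proof.
move=> Hg Hh; elim: Hg => [|m' x y g' Hx Hy _ IH]; first by rewrite mul1g.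
by rewrite -mulgA; apply: commutator_product_cons.
Qed.

Lemma commutator_product_inv n g :
  commutator_product_in H n g -> commutator_product_in H n g^-1.
Proof.
elim=> [|m x y h Hx Hy _ IH]; first by rewrite invg1; exact: commutator_product_nil.
have -> : ([~ x, y] * h)^-1 = h^-1 * [~ y, x].
  by rewrite invgM /commg !conjgE !invgM !invgK !mulgA.
by rewrite -addn1; apply/commutator_product_mul/commutator_product_comm.
Qed.

Lemma commutator_product_exp m g n :
  commutator_product_in H m g -> commutator_product_in H (n * m) (g ^+ n).
Proof.
move=> Hg; elim: n => [|n IH]; first exact: commutator_product_nil.
by rewrite expgS mulSn; apply: commutator_product_mul.
Qed.

Lemma commutator_subgroup_product g :
  commutator_subgroup H g -> exists n, commutator_product_in H n g.
Proof.
move: g; apply: smallest_sub.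
  split; rewrite ?inE; first by exists 0%N; exact: commutator_product_nil.
  move=> g h; rewrite !inE => -[m Hg] [n Hh]; exists (m + n)%N.
  exact/commutator_product_mul/commutator_product_inv.
move=> _ [x Hx [y Hy <-]]; exists 1%N; exact: commutator_product_comm.
Qed.

(** A map multiplicative on the subgroup [H] sends commutators of elements of
    [H] to commutators. The images need not lie in [H]. *)
Lemma commutator_product_morph (D : G -> G) n g :
  is_subgroup H -> (forall x y, H x -> H y -> D (x * y) = D x * D y) ->
  commutator_product_in H n g -> commutator_product_in setT n (D g).
Proof.
move=> [H1 HV] DM.
have {}H1 : H 1 by rewrite inE in H1.
have {}HV x y : H x -> H y -> H (x * y^-1).
  by move=> Hx Hy; move: (HV x y); rewrite !inE; apply.
have HI x : H x -> H x^-1 by move=> Hx; rewrite -[_^-1]mul1g; apply: HV.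
have HM x y : H x -> H y -> H (x * y).
  by move=> Hx Hy; rewrite -[y]invgK; apply/HV/HI.
have D1 : D 1 = 1 by apply: (@mulgI _ (D 1)); rewrite -DM// !mulg1.
have DV x : H x -> D x^-1 = (D x)^-1.
  move=> Hx; apply: (@mulgI _ (D x)); rewrite -DM ?mulgV//; exact: HI.
have HR x y : H x -> H y -> H [~ x, y].
  move=> Hx Hy; rewrite /commg conjgE; apply/HM; [exact: HI|apply/HM; [exact: HI|exact: HM]].
have HP m h : commutator_product_in H m h -> H h.
  by elim=> // p x y h' Hx Hy _; apply/HM/HR.
elim=> [|m x y h Hx Hy Hh IH]; first by rewrite D1; exact: commutator_product_nil.
have -> : D ([~ x, y] * h) = [~ D x, D y] * D h.
  rewrite DM; [|exact: HR|exact: HP Hh]; congr (_ * _).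
  by rewrite /commg !conjgE !DM ?DV//; auto.
exact: commutator_product_cons.
Qed.

End CommutatorProducts.

(** * Commutator counts of powers *)

Section CommutatorLength.
Variable G : groupType.
Implicit Types (g h x y : G) (m n : nat).

Local Notation cprod := (@commutator_product_in G setT).

Lemma commutator_product_inT n g : cprod n g -> is_commutator_product n g.
Proof.
elim=> [|m x y h _ _ _ [a [b ->]]].
  by exists (fun=> 1), (fun=> 1); rewrite big_ord0.
exists (fun i => oapp a x (unlift ord0 i)), (fun i => oapp b y (unlift ord0 i)).
rewrite big_ord_recl unlift_none /=; congr (_ * _).
by apply: eq_bigr => i _; rewrite liftK.
Qed.

Lemma commutator_length_le n g : cprod n g -> (commutator_length g <= n)%N.
Proof.
move=> /commutator_product_inT gn; rewrite /commutator_length.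
(* In the second case the value is the default 0, for which the bound is
   trivial; so the existence of a minimum is not at issue. *)
by case: xgetP => [m _ [_ ]|_]; first exact.
Qed.

Lemma commutator_product_conj n g h : cprod n g -> cprod n (g ^ h).
Proof.
move=> gn; apply: (@commutator_product_morph _ setT (fun x => x ^ h)) gn.
  by split=> [|x y]; rewrite !inE.
by move=> x y _ _; exact: conjMg.
Qed.

(** Passing from [n] to [n.+1] only requires moving one [h] across [g ^+ n],
    which costs one commutator; the commutators already counted are merely
    conjugated. *)
Lemma commutator_product_expM g h n :
  cprod n ((g * h) ^+ n * (g ^+ n * h ^+ n)^-1).
Proof.
elim: n => [|n IH]; first by rewrite !expg0 mulg1 mulgV; exact: commutator_product_nil.
set d := (X in cprod n X) in IH.
have -> : (g * h) ^+ n.+1 * (g ^+ n.+1 * h ^+ n.+1)^-1 =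
  d ^ (g * h)^-1 * [~ h^-1, g ^- n] ^ g^-1.
  rewrite /d !expgS /commg !conjgE !invgM !invgK !mulgA.
  by rewrite !mulgVK.
rewrite -addn1; apply: commutator_product_mul; apply: commutator_product_conj => //.
exact: commutator_product_comm.
Qed.

Lemma commutator_product_exp_prod k (f : 'I_k -> G) n c :
  (forall i, cprod c (f i ^+ n)) -> cprod (k * (n + c)) ((\prod_(i < k) f i) ^+ n).
Proof.
elim: k f => [|k IH] f cf.
  by rewrite big_ord0 expg1n; exact: commutator_product_nil.
rewrite big_ord_recl; set h := \prod_(i < k) _.
rewrite mulSn -addnA -[X in cprod _ X](mulgVK (f ord0 ^+ n * h ^+ n)).
apply: commutator_product_mul; first exact: commutator_product_expM.
by apply: commutator_product_mul => //; exact: IH.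
Qed.

(** Each factor [g] exchanged for [g ^ h i] costs one commutator, because
    [g * (g ^ h i)^-1] is a commutator. *)
Lemma commutator_product_exp_conjs n (h : 'I_n -> G) g :
  cprod n (g ^+ n * (\prod_(i < n) g ^ h i)^-1).
Proof.
elim: n h => [|n IH] h.
  by rewrite expg0 big_ord0 mulgV; exact: commutator_product_nil.
rewrite big_ord_recl.
have := IH (fun i => h (lift ord0 i)); set p := \prod_(i < n) _ => IHh.
have -> : g ^+ n.+1 * (g ^ h ord0 * p)^-1 =
  (g ^+ n * p^-1) ^ g^-1 * [~ g^-1, h ord0].
  by rewrite expgS /commg conjVg invgM [_ ^ g^-1]conjgE !invgK !mulgA mulgVK.
rewrite -addn1; apply: commutator_product_mul; last exact: commutator_product_comm.
exact: commutator_product_conj.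
Qed.

(** Commutation between different conjugates allows the factors coming from
    [x] to be collected to the left of those coming from [y]; factors with the
    same index never have to be exchanged. *)
Lemma prod_conj_displaced n (h : 'I_n -> G) (H : set G) x y :
  (forall i j, i != j -> forall x y, H x -> H y -> commute (x ^ h i) (y ^ h j)) ->
  H x -> H y ->
  \prod_(i < n) (x * y) ^ h i =
  (\prod_(i < n) x ^ h i) * (\prod_(i < n) y ^ h i).
Proof.
move=> hC Hx Hy; elim: n h hC => [|n IH] h hC; first by rewrite !big_ord0 mulg1.
rewrite !big_ord_recl IH => [|i j ij]; last first.
  by apply: hC; rewrite (inj_eq lift_inj).
rewrite conjMg; set X := \prod_(i < n) x ^ _; set Y := \prod_(i < n) y ^ _.
have yX : commute (y ^ h ord0) X.
  by apply: commute_prod => i _; apply: hC => //; rewrite neq_lift.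
suff swap (a b c d : G) : commute b c -> a * b * (c * d) = a * c * (b * d).
  exact: swap.
by move=> bc; rewrite -!mulgA (mulgA b c) bc -mulgA.
Qed.

(** The count [m + c] replaces the obvious [m * c]: the [m] conjugates of [g]
    are written simultaneously with [c] commutators, and [m] further ones
    convert their product into [g ^+ m]. *)
Lemma commutator_product_exp_displaced (H : set G) m (h : 'I_m -> G) g :
  is_subgroup H ->
  (forall i j : 'I_m, i != j ->
    forall x y, H x -> H y -> commute (x ^ h i) (y ^ h j)) ->
  forall c, commutator_product_in H c g -> cprod (m + c) (g ^+ m).
Proof.
move=> HG hC c cg.
rewrite -(mulgVK (\prod_(i < m) g ^ h i) (g ^+ m)).
apply: commutator_product_mul; first exact: commutator_product_exp_conjs.
apply: (@commutator_product_morph _ H (fun x => \prod_(i < m) x ^ h i)) cg => //.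
by move=> x y Hx Hy; exact: prod_conj_displaced hC Hx Hy.
Qed.

(** Writing [N] as a multiple of [n * P] plus a remainder, the multiple
    contributes at most [A / n] per unit of [N], and the remainder a bounded
    amount. *)
Lemma commutator_length_exp_linear g c n A P :
  cprod c g -> (0 < P)%N -> cprod (A * P) (g ^+ (n * P)) ->
  exists K, forall N, (n * commutator_length (g ^+ N) <= A * N + K)%N.
Proof.
move=> cg P0 cP; have [->|n0] := posnP n; first by exists 0%N => N; rewrite mul0n.
exists (n * (n * P * c))%N => N.
set Q := (n * P)%N; have Q0 : (0 < Q)%N by rewrite muln_gt0 n0.
have cN : cprod (N %/ Q * (A * P) + N %% Q * c) (g ^+ N).
  rewrite [in X in cprod _ X](divn_eq N Q) expgnDr [(N %/ Q * Q)%N]mulnC expgnA.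
  by apply: commutator_product_mul; apply: commutator_product_exp.
have := commutator_length_le cN.
have := divn_eq N Q; have := ltn_pmod N Q0.
move: (N %/ Q) (N %% Q) (commutator_length _) => q r l rQ NE lE.
apply: leq_trans (_ : n * (q * (A * P) + r * c) <= _)%N; first by rewrite leq_mul2l lE orbT.
rewrite mulnDr leq_add//; last by rewrite leq_mul2l leq_mul2r ltnW ?orbT.
rewrite NE /Q; nia.
Qed.

End CommutatorLength.

(** Raising each [f i] to a common multiple [P] of the exponents preserves the
    rate of two commutators per unit of exponent. Separating the [k] factors of
    the product adds one more unit per factor, whence the [3]. *)
Lemma exp_prod_common_power (G : groupType) k (f : 'I_k -> G) :
  (forall i, exists m, (0 < m)%N /\ commutator_product_in setT (m + m) (f i ^+ m)) ->
  exists P, (0 < P)%N /\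
    commutator_product_in setT (3 * k * P)%N ((\prod_(i < k) f i) ^+ P).
Proof.
move=> /choice[m mP]; pose P := (\prod_(i < k) m i)%N.
exists P; split; first by rewrite prodn_gt0// => i; have [] := mP i.
have -> : (3 * k * P = k * (P + (P + P)))%N by lia.
apply: commutator_product_exp_prod => i.
have [q ->] : exists q, P = (m i * q)%N.
  by exists (P %/ m i)%N; rewrite mulnC divnK// /P (bigD1 i)//= dvdn_mulr.
rewrite expgnA -mulnDl mulnC.
by apply: commutator_product_exp; have [] := mP i.
Qed.

(** * Passage to the limit *)

(** The limit superior of [u N / N] is at most [A / n] for every positive [n],
    because the constant [K] depends on [n] but not on [N]. *)
Lemma div_index_cvg0 (R : realType) (u : nat -> nat) (A : nat) :
  (forall n, exists K, forall N, (n * u N <= A * N + K)%N) ->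
  ((fun N => (u N)%:R / N%:R : R)%R) @ \oo --> (0 : R)%R.
Proof.
move=> uA; apply/cvgr0Pnorm_lt => e e0.
(* The spare unit in [A.+1] absorbs the constant [K] once [K < N]. *)
have [n nA] : exists n : nat, (A.+1%:R / e < n%:R :> R)%R.
  by exists (Num.bound (A.+1%:R / e)%R); apply: archi_boundP; rewrite divr_ge0// ltW.
have [K uK] := uA n.
near=> N.
have N0 : (0 < N%:R :> R)%R by rewrite ltr0n; near: N; exact: nbhs_infty_gt.
rewrite ger0_norm ?divr_ge0// ltr_pdivrMr//.
have KN : (K < N)%N by near: N; exact: nbhs_infty_gt.
have n0 : (0 < n%:R :> R)%R by apply: le_lt_trans nA; rewrite divr_ge0// ltW.
rewrite -(ltr_pM2l n0) -natrM.
have lt1 : (n * u N < A.+1 * N)%N.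
  by apply: leq_ltn_trans (uK N) _; rewrite mulSn addnC ltn_add2r.
apply: (@lt_trans _ _ (A.+1%:R * N%:R)%R); first by rewrite -natrM ltr_nat.
by rewrite mulrA ltr_pM2r// -ltr_pdivrMr.
Unshelve. all: by end_near.
Qed.

Theorem theorem2p3 (R : realType) (Gamma : groupType)
    (L : set (set Gamma)) (k : nat)
    (L_subgroup : forall Lambda, L Lambda -> is_subgroup Lambda)
    (k_gt0 : (0 < k)%N)
    (L_gen : forall x : Gamma, exists f : 'I_k -> Gamma,
        (forall i, exists Lambda, L Lambda /\ Lambda (f i)) /\
        x = \prod_(i < k) f i)
    (L_perfect : forall Lambda, L Lambda -> perfect Lambda)
    (L_commute : forall Lambda, L Lambda ->
        forall n : nat, (0 < n)%N ->
        exists g : 'I_n -> Gamma,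
        forall i j : 'I_n, i != j ->
        forall x y : Gamma, Lambda x -> Lambda y ->
        commute (g i * x * (g i)^-1) (g j * y * (g j)^-1)) :
  forall g : Gamma, commutator_subgroup [set: Gamma] g ->
  cvgn (scl_seq R g) /\ scl R g = 0%R.
Proof.
have short f Lambda : L Lambda -> Lambda f ->
    exists m, (0 < m)%N /\ commutator_product_in setT (m + m) (f ^+ m).
  move=> LL; rewrite -{1}(L_perfect _ LL) => /commutator_subgroup_product[m fm].
  (* [m] itself may be zero, so one trivial commutator is added. *)
  exists m.+1; split=> //; have [g gC] := L_commute _ LL m.+1 isT.
  have fm1 : commutator_product_in Lambda m.+1 f.
    have [L1 _] := L_subgroup _ LL; rewrite inE in L1.
    by rewrite -[f]mul1g -(commg1 1); exact: commutator_product_cons.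
  apply: (@commutator_product_exp_displaced _ Lambda _ (fun i => (g i)^-1)) fm1.
    exact: L_subgroup.
  by move=> i j ij x y Lx Ly; rewrite !conjgE !invgK !mulgA; exact: gC.
move=> g /commutator_subgroup_product[c gc].
have cvg0 : scl_seq R g @ \oo --> (0 : R)%R.
  apply: (@div_index_cvg0 R _ (3 * k)) => n.
  have [f [fL gnE]] := L_gen (g ^+ n).
  have [i|P [P0 gP]] := @exp_prod_common_power _ k f.
    by have [Lambda [LL Lf]] := fL i; exact: short LL Lf.
  apply: commutator_length_exp_linear gc P0 _.
  by rewrite expgnA gnE.
by split; [apply/cvg_ex; exists 0%R|apply: cvg_lim].
Qed.
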